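(* If $S$ is a locating-dominating set for a hypergraph $H$ with $n$ vertices, then $\lambda(H)\le |S|\le n-1$, and this bound is sharp.
   Context: A hypergraph $H$ is a pair $(V(H),E(H))$ with $V(H)$ a finite set and $E(H)$ a finite family of non-empty subsets of $V(H)$ (hyperedges) whose union is $V(H)$. Standing assumption: all hypergraphs are connected (any two vertices are joined by a path $v,E_1,w_1,E_2,\ldots,w_{l-1},E_l,u$ with $v\in E_1$, $w_i\in E_i\cap E_{i+1}$, $u\in E_l$) and Sperner (no hyperedge is a subset of another hyperedge). For a vertex $u$, $N(u)$ is the set of vertices $v\ne u$ such that some hyperedge contains both $u$ and $v$. A set $S\subseteq V(H)$ is locating-dominating if for any two distinct $u,v\in V(H)-S$, $N(u)\cap S\neq N(v)\cap S$, and $N(u)\cap S\ne\emptyset$ for every $u\in V(H)-S$. The location-domination number $\lambda(H)$ is the minimum cardinality of a locating-dominating set of $H$. The bound referred to as sharp is the upper bound $n-1$ on the location-domination number; sharp means that it is attained.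
   Formalization: The bound |S| ≤ n−1 is stated only for S ≠ V(H), since V(H) itself is vacuously locating-dominating with n elements; λ(H) ≤ n−1 is stated for n ≥ 2, since λ = 1 for one vertex; sharpness is attainment of λ(H) = n−1 for every n ≥ 2. *)

(* Defs.v *)
From mathcomp Require Import all_boot.

Set Implicit Arguments.
Unset Strict Implicit.
Unset Printing Implicit Defensive.

(* The vertex set V(H) is the whole type V, so n is #|V|.  The hyperedges form
   a set rather than a multiset: the Sperner condition excludes repetitions. *)
Record hypergraph (V : finType) := Hypergraph {
  edges : {set {set V}};
  edges_nonempty : set0 \notin edges;
  edges_cover : cover edges = [set: V] }.

(* The path v, E_1, w_1, E_2, ..., w_(l-1), E_l, u is encoded by v and the
   sequence (E_1, w_1), ..., (E_l, w_l) with w_l = u. *)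
Fixpoint hpath (V : finType) (H : hypergraph V) (v : V)
    (p : seq ({set V} * V)) (u : V) : bool :=
  if p is (e, w) :: p' then
    [&& e \in edges H, v \in e, w \in e & hpath H w p' u]
  else v == u.

Definition connected (V : finType) (H : hypergraph V) : Prop :=
  forall u v : V, exists p, hpath H v p u.

Definition sperner (V : finType) (H : hypergraph V) : Prop :=
  forall e f : {set V},
    e \in edges H -> f \in edges H -> e \subset f -> e = f.

Definition neighborhood (V : finType) (H : hypergraph V) (u : V) : {set V} :=
  [set v | (v != u) && [exists e in edges H, (u \in e) && (v \in e)]].

Definition locating_dominating (V : finType) (H : hypergraph V)
    (S : {set V}) : bool :=
  [forall u in ~: S, forall v in ~: S,
     (u != v) ==> (neighborhood H u :&: S != neighborhood H v :&: S)]
  && [forall u in ~: S, neighborhood H u :&: S != set0].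

Lemma locating_dominating_setT (V : finType) (H : hypergraph V) :
  locating_dominating H [set: V].
Proof.
by rewrite /locating_dominating setCT; apply/andP; split;
  apply/forall_inP => u; rewrite inE.
Qed.

(* By the previous lemma, [set: V] is an admissible candidate, so the
   arg min is over a nonempty collection. *)
Definition location_domination_number (V : finType) (H : hypergraph V) : nat :=
  #|[arg min_(S < [set: V] | locating_dominating H S) #|S|]|.

(* Main.v *)
Require Import Defs.
From mathcomp Require Import all_boot.

(** The inequality [lambda(H) <= |S|] holds because [lambda(H)] is a minimum,
    and a set other than the whole vertex set misses a vertex, hence has at
    most [n - 1] elements.  Such a locating-dominating set exists as soon as
    there are two vertices: connectedness gives every vertex [x] a neighbor
    ([neighborhood_neq0]), so the complement of [x] dominates [x], and with a
    single vertex outside there is nothing to locate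
    ([locating_dominating_setC1]).

    For sharpness, consider a hypergraph in which any two vertices are
    adjacent.  A vertex outside [S] then sees all of [S], so two distinct
    vertices outside [S] cannot be told apart, and a locating-dominating set
    misses at most one vertex ([pred_leq_card_locating_dominating]).  The
    hypergraph with the whole vertex set as its only hyperedge is connected,
    Sperner and of this kind, for every positive number of vertices. *)

Lemma in_neighborhood (V : finType) (H : hypergraph V) (u v : V) :
  reflect (v != u /\ exists e, [/\ e \in edges H, u \in e & v \in e])
          (v \in neighborhood H u).
Proof.
rewrite inE; apply: (iffP andP) => -[vDu].
  by case/exists_inP=> e eH /andP[ue ve]; split=> //; exists e.
case=> e [eH ue ve]; split=> //.
by apply/exists_inP; exists e; rewrite ?ue.
Qed.

Lemma location_domination_number_le (V : finType) (H : hypergraph V)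
    (S : {set V}) :
  locating_dominating H S -> location_domination_number H <= #|S|.
Proof.
rewrite /location_domination_number.
case: arg_minnP => [|T _ minT]; first exact: locating_dominating_setT.
exact: minT.
Qed.

Lemma location_domination_number_ge (V : finType) (H : hypergraph V) (m : nat) :
  (forall S, locating_dominating H S -> m <= #|S|) ->
  m <= location_domination_number H.
Proof.
rewrite /location_domination_number => min_m.
case: arg_minnP => [|T ldT _]; first exact: locating_dominating_setT.
exact: min_m.
Qed.

Lemma card_neqT (V : finType) (S : {set V}) :
  S != [set: V] -> #|S| <= #|V| - 1.
Proof.
rewrite -properT => /proper_card; rewrite cardsT => ltSV.
by rewrite subn1 -ltnS (ltn_predK ltSV).
Qed.

(** The first step of a path that leaves [x] leads to a neighbor of [x]; steps
    that stay at [x], which a path may contain, are skipped by induction. *)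
Lemma neighborhood_neq0 (V : finType) (H : hypergraph V) (x y : V) :
  connected H -> y != x -> neighborhood H x != set0.
Proof.
move=> /(_ y x)[p]; elim: p => [|[e w] p IHp] /=.
  by move=> /eqP-> /eqP.
case/and4P=> eH xe we path_wy yDx.
have [w_x | wDx] := eqVneq w x; first by apply: IHp; rewrite -?w_x // w_x.
by apply/set0Pn; exists w; apply/in_neighborhood; split=> //; exists e.
Qed.

Lemma locating_dominating_setC1 (V : finType) (H : hypergraph V) (x : V) :
  neighborhood H x != set0 -> locating_dominating H (~: [set x]).
Proof.
move=> Nx_neq0; rewrite /locating_dominating setCK; apply/andP; split.
  apply/forall_inP=> u /set1P->; apply/forall_inP=> v /set1P->.
  by rewrite eqxx.
apply/forall_inP=> u /set1P->.
have [z zNx] := set0Pn _ Nx_neq0.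
have /in_neighborhood[zDx _] := zNx.
by apply/set0Pn; exists z; rewrite in_setI zNx in_setC1.
Qed.

(** Two distinct vertices outside [S] would both have trace [S] on [S]. *)
Lemma pred_leq_card_locating_dominating (V : finType) (H : hypergraph V)
    (S : {set V}) :
  (forall u v, v != u -> v \in neighborhood H u) ->
  locating_dominating H S -> #|V| - 1 <= #|S|.
Proof.
move=> adjH /andP[/forall_inP locS _].
have traceS u : u \in ~: S -> neighborhood H u :&: S = S.
  rewrite in_setC => uS; apply/setIidPr/subsetP=> z zS.
  by apply: adjH; apply: contraNneq uS => <-.
have leC1 : #|~: S| <= 1.
  apply/card_le1_eqP=> v u vS uS; apply: (@eqP _ u v).
  have /forall_inP/(_ v vS) := locS u uS.
  by rewrite !traceS // eqxx implybF negbK.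
by rewrite leq_subLR -(cardsC S) addnC leq_add2r.
Qed.

Section OneEdge.

Variables (V : finType) (x0 : V).

Lemma one_edge_nonempty : set0 \notin [set [set: V]].
Proof. by rewrite inE eq_sym; apply/set0Pn; exists x0. Qed.

Lemma one_edge_cover : cover [set [set: V]] = [set: V].
Proof. by rewrite /cover big_set1. Qed.

Definition one_edge_hypergraph : hypergraph V :=
  Hypergraph one_edge_nonempty one_edge_cover.

Lemma one_edge_adjacent (u v : V) :
  v != u -> v \in neighborhood one_edge_hypergraph u.
Proof.
by move=> vDu; apply/in_neighborhood; split=> //; exists setT; rewrite !inE.
Qed.

Lemma one_edge_connected : connected one_edge_hypergraph.
Proof. by move=> u v; exists [:: (setT, u)]; rewrite /= !inE !eqxx. Qed.

Lemma one_edge_sperner : sperner one_edge_hypergraph.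
Proof. by move=> e f /set1P-> /set1P->. Qed.

End OneEdge.

Lemma location_domination_number_le_pred (V : finType) (H : hypergraph V) :
  connected H -> 2 <= #|V| -> location_domination_number H <= #|V| - 1.
Proof.
move=> connH /card_gt1P[x [y [_ _ xDy]]].
have Nx_neq0 : neighborhood H x != set0.
  by apply: (neighborhood_neq0 _ _ _ y) => //; rewrite eq_sym.
rewrite subn1 -(cardsC1 x).
exact/location_domination_number_le/locating_dominating_setC1.
Qed.

Theorem lemma2p10 :
  (forall (V : finType) (H : hypergraph V) (S : {set V}),
     connected H -> sperner H -> locating_dominating H S ->
     location_domination_number H <= #|S| /\
     (S != [set: V] -> #|S| <= #|V| - 1)) /\
  (forall (V : finType) (H : hypergraph V),
     connected H -> sperner H -> 2 <= #|V| ->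
     location_domination_number H <= #|V| - 1) /\
  (forall n : nat, 2 <= n ->
     exists (V : finType) (H : hypergraph V),
       [/\ #|V| = n, connected H, sperner H &
           location_domination_number H = n - 1]).
Proof.
split=> [V H S _ _ ldS | ].
  by split; [exact: location_domination_number_le | exact: card_neqT].
split=> [V H connH _ | n n_ge2]; first exact: location_domination_number_le_pred.
have x0 : 'I_n := Ordinal (ltnW n_ge2).
pose H := one_edge_hypergraph _ x0.
have connH : connected H by exact: one_edge_connected.
exists 'I_n, H; split; [exact: card_ord | by [] | exact: one_edge_sperner | ].
have -> : n - 1 = #|'I_n| - 1 by rewrite card_ord.
apply/eqP; rewrite eqn_leq; apply/andP; split.
  by apply: location_domination_number_le_pred; rewrite ?card_ord.
apply: location_domination_number_ge => S.
by apply: pred_leq_card_locating_dominating; exact: one_edge_adjacent.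
Qed.
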